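(* For all integers $n, j \geq 0$ and $k, b \geq 1$, $$O_{j,k,b}(n) = D_{j,k,b}(n).$$
   Context: A partition of a positive integer $n$ is a finite non-increasing sequence of positive integers, called parts, that sum to $n$; the empty partition is the unique partition of $0$. For integers $n,j\geq 0$ and $k,b\geq 1$: - $O_{j,k,b}(n)$ is the number of partitions of $n$ with exactly $j$ different parts divisible by $kb$ (repetitions allowed), i.e. the set of distinct part sizes that occur in the partition and are divisible by $kb$ has exactly $j$ elements, with each such part allowed to occur any positive number of times. - $D_{j,k,b}(n)$ is the number of partitions of $n$ with exactly $j$ different parts that are both divisible by $b$ and appear at least $k$ times, i.e. there are exactly $j$ distinct part sizes $i$ with $b\mid i$ such that $i$ occurs at least $k$ times in the partition. *)

(* Defs.v *)
From mathcomp Require Import all_boot.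

Set Implicit Arguments.
Unset Strict Implicit.
Unset Printing Implicit Defensive.

Definition is_partition (n : nat) (s : seq nat) : bool :=
  [&& sorted geq s, all (fun i => 0 < i) s & sumn s == n].

(* A partition of n has at most n parts, each at most n, so the partitions of n
   live in the finite type of sequences of length at most n over 'I_n.+1; no
   partition is lost by this bound (parts_of_surj). *)
Definition parts_of (n : nat) (s : n.-bseq 'I_n.+1) : seq nat := map val s.

Lemma parts_of_inj (n : nat) : injective (@parts_of n).
Proof. by move=> s t /(inj_map val_inj) /val_inj. Qed.

Lemma parts_of_surj (n : nat) (s : seq nat) :
  is_partition n s -> exists t : n.-bseq 'I_n.+1, parts_of t = s.
Proof.
case/and3P=> _ s_gt0 /eqP sum_s.
have size_s : size [seq inord i : 'I_n.+1 | i <- s] <= n.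
  rewrite size_map -[X in _ <= X]sum_s {sum_s}.
  elim: s s_gt0 => //= i s IHs /andP[i_gt0 /IHs].
  by rewrite -add1n; apply: leq_add.
exists (Bseq size_s); rewrite /parts_of /= -map_comp map_id_in // => i s_i /=.
rewrite inordK // ltnS -sum_s {sum_s size_s s_gt0}.
elim: s s_i => //= a s IHs; rewrite inE => /predU1P[-> | /IHs le_i].
  exact: leq_addr.
exact: leq_trans le_i (leq_addl _ _).
Qed.

Definition num_partitions (n : nat) (P : pred (seq nat)) : nat :=
  #|[set s : n.-bseq 'I_n.+1 | is_partition n (parts_of s) && P (parts_of s)]|.

Definition num_distinct_parts (a : pred nat) (s : seq nat) : nat :=
  count a (undup s).

Definition O_count (j k b n : nat) : nat :=
  num_partitions n
    (fun s => num_distinct_parts (fun i => k * b %| i) s == j).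

Definition D_count (j k b n : nat) : nat :=
  num_partitions n
    (fun s => num_distinct_parts
                (fun i => (b %| i) && (k <= count_mem i s)) s == j).

(* Main.v *)
Require Import Defs.
From mathcomp Require Import all_boot.

Set Implicit Arguments.
Unset Strict Implicit.
Unset Printing Implicit Defensive.

(** Both statistics are refined to set-valued ones.  With a partition [s] of [n]
    associate the set [multiple_parts] of the multiples [t] of [b] such that
    [k * t] is a part of [s], and the set [frequent_parts] of the multiples [t]
    of [b] that occur at least [k] times in [s].  Their cardinals are the two
    numbers of distinct parts being compared ([card_multiple_parts],
    [card_frequent_parts]), and the sets themselves are equidistributed.

    By Moebius inversion on the lattice of subsets ([card_fiber_eq]), it is
    enough to show that, for every [T], as many partitions have
    [multiple_parts] containing [T] as have [frequent_parts] containing [T].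
    When all elements of [T] are multiples of [b], the former are the
    partitions that contain one copy of [k * t] for each [t] in [T], the latter
    those that contain [k] copies of each [t] in [T].  These two prescribed
    multisets have the same sum, and removing a prescribed multiset of sum [m]
    leaves an arbitrary partition of [n - m] ([num_partitions_containing]).  So
    both numbers are the number of partitions of [n - m] if [m <= n] and [0] is
    not in [T], and both vanish otherwise. *)

(** * Equidistribution of set-valued statistics *)

(** Descending induction on [T]: the elements with [T \subset A x] are those
    with [A x = T] together with those for which [A x] is a strictly larger
    set, and the latter are counted by the induction hypothesis. *)
Lemma card_fiber_eq (X I : finType) (D : {set X}) (A B : X -> {set I}) :
    (forall T : {set I}, #|[set x in D | T \subset A x]|
                            = #|[set x in D | T \subset B x]|) ->
  forall T, #|[set x in D | A x == T]| = #|[set x in D | B x == T]|.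
Proof.
move=> eqAB T.
have split_card (C : X -> {set I}) (S : {set I}) :
    #|[set x in D | S \subset C x]|
    = #|[set x in D | C x == S]|
      + \sum_(R : {set I} | S \proper R) #|[set x in D | C x == R]|.
  rewrite -sum1_card (partition_big C (fun R => S \subset R)) /=; last first.
    by move=> x; rewrite inE => /andP[].
  rewrite (bigD1 S) //=; congr (_ + _).
    rewrite -sum1_card; apply: eq_bigl => x; rewrite !inE.
    by case: eqP => [->|_]; rewrite ?subxx ?andbT ?andbF.
  apply: eq_big => [R | R /andP[sSR _]].
    by rewrite properEneq andbC eq_sym.
  rewrite -sum1_card; apply: eq_bigl => x; rewrite !inE.
  by case: eqP => [->|_]; rewrite ?sSR ?andbT ?andbF.
have [m] := ubnP #|~: T|; elim: m T => // m IHm T ltTm.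
have := eqAB T; rewrite !split_card.
rewrite (eq_bigr (fun R => #|[set x in D | B x == R]|)) => [|R ltTR].
  exact: addIn.
apply: IHm; apply: leq_trans _ (ltTm : #|~: T| <= m).
by rewrite proper_card ?properC ?setCK.
Qed.

Lemma card_level_eq (X I : finType) (D : {set X}) (A B : X -> {set I}) j :
    (forall T, #|[set x in D | A x == T]| = #|[set x in D | B x == T]|) ->
  #|[set x in D | #|A x| == j]| = #|[set x in D | #|B x| == j]|.
Proof.
move=> eqAB.
have sum_fibers (C : X -> {set I}) :
    #|[set x in D | #|C x| == j]|
    = \sum_(T : {set I} | #|T| == j) #|[set x in D | C x == T]|.
  rewrite -sum1_card (partition_big C (fun T => #|T| == j)) /=; last first.
    by move=> x; rewrite inE => /andP[].
  apply: eq_bigr => T cardT; rewrite -sum1_card; apply: eq_bigl => x.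
  by rewrite !inE; case: (C x =P T) => [->|_]; rewrite ?cardT ?andbT ?andbF.
by rewrite !sum_fibers (eq_bigr _ (fun T _ => eqAB T)).
Qed.

(** * Partitions containing a prescribed multiset of parts *)

Definition partitions (n : nat) : seq (seq nat) :=
  [seq parts_of t | t <- enum {: n.-bseq 'I_n.+1} & is_partition n (parts_of t)].

Lemma partitions_uniq n : uniq (partitions n).
Proof. by rewrite (map_inj_uniq (@parts_of_inj n)) filter_uniq ?enum_uniq. Qed.

Lemma mem_partitions n s : (s \in partitions n) = is_partition n s.
Proof.
apply/mapP/idP => [[t] | part_s].
  by rewrite mem_filter => /andP[part_t _] ->.
have [t def_s] := parts_of_surj part_s.
by exists t => //; rewrite mem_filter mem_enum def_s part_s.
Qed.

Lemma num_partitionsE n P : num_partitions n P = count P (partitions n).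
Proof.
rewrite /num_partitions count_map count_filter cardE -size_filter.
rewrite !enumT; congr (size _).
by apply: eq_filter => t; rewrite !inE /= andbC.
Qed.

(** Inclusion of multisets, with [u] and [s] read up to permutation. *)
Definition contains (u s : seq nat) : bool :=
  all (fun x => count_mem x u <= count_mem x s) u.

Lemma containsP u s : reflect (exists w, perm_eq s (u ++ w)) (contains u s).
Proof.
apply: (iffP allP) => [le_us | [w /permP eq_s] x _]; last first.
  by rewrite eq_s count_cat leq_addr.
have [|v sub_vs eq_uv] := (count_subseqP u s).1.
  move=> x; have [/le_us //|] := boolP (x \in u).
  by move=> /count_memPn->.
have [w eq_s] := perm_to_subseq sub_vs.
by exists w; rewrite (perm_trans eq_s) // perm_cat2r perm_sym.
Qed.

(** Adding the parts in [u] is a bijection from the partitions of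
    [n - sumn u] to the partitions of [n] that contain [u]. *)
Lemma num_partitions_containing n u :
  num_partitions n (contains u)
  = if all (leq 1) u && (sumn u <= n) then num_partitions (n - sumn u) predT
    else 0.
Proof.
rewrite !num_partitionsE; case: ifPn => [/andP[u_gt0 le_un] | not_u].
  rewrite count_predT -size_filter.
  rewrite -[RHS](size_map (fun w => sort geq (u ++ w))).
  have geq_tr : transitive geq by move=> x y z le_xy /leq_trans; apply.
  have geq_anti : antisymmetric geq by move=> x y /anti_leq.
  have geq_total : total geq by move=> x y; apply: leq_total.
  apply: perm_size; apply: uniq_perm.
  - by rewrite filter_uniq ?partitions_uniq.
  - rewrite map_inj_in_uniq ?partitions_uniq // => v w.
    rewrite !mem_partitions => /and3P[sorted_v _ _] /and3P[sorted_w _ _].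
    move=> /perm_sortP-/(_ geq_total geq_tr geq_anti); rewrite perm_cat2l.
    exact: (sorted_eq geq_tr geq_anti).
  move=> s; rewrite mem_filter mem_partitions; apply/andP/mapP.
    case=> /containsP[w eq_s] /and3P[sorted_s s_gt0 /eqP sum_s].
    have eq_sw: perm_eq s (u ++ sort geq w).
      by rewrite (perm_trans eq_s) // perm_cat2l perm_sym perm_sort.
    exists (sort geq w).
      rewrite mem_partitions /is_partition sort_sorted //=.
      move: s_gt0; rewrite (perm_all _ eq_sw) all_cat => /andP[_ ->] /=.
      by rewrite -sum_s (perm_sumn eq_sw) sumn_cat addKn.
    rewrite -[LHS](sorted_sort geq_tr sorted_s).
    exact/perm_sortP.
  case=> w; rewrite mem_partitions => /and3P[_ w_gt0 /eqP sum_w] ->; split.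
    by apply/containsP; exists w; rewrite perm_sort.
  rewrite /is_partition sort_sorted //= all_sort all_cat u_gt0 w_gt0 /=.
  by rewrite (perm_sumn (permEl (perm_sort _ _))) sumn_cat sum_w subnKC.
apply/eqP; rewrite -leqn0 leqNgt -has_count; apply: contra not_u.
case/hasP=> s; rewrite mem_partitions => /and3P[_ s_gt0 /eqP <-].
case/containsP=> w eq_s; move: s_gt0.
by rewrite (perm_all _ eq_s) (perm_sumn eq_s) all_cat sumn_cat leq_addr => /andP[->].
Qed.

(** * The two set-valued statistics *)

Section Statistics.

Variables n k b : nat.
Hypothesis k_gt0 : 0 < k.

(** The members are the quotients by [k] of the parts divisible by [k * b], so
    that both statistics take values among sets of multiples of [b]. *)
Definition multiple_parts (s : seq nat) : {set 'I_n.+1} :=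
  [set t : 'I_n.+1 | (b %| t) && (k * t \in s)].

Definition frequent_parts (s : seq nat) : {set 'I_n.+1} :=
  [set t : 'I_n.+1 | (b %| t) && (k <= count_mem (val t) s)].

Lemma part_le s i : is_partition n s -> i \in s -> i <= n.
Proof.
case/and3P=> _ _ /eqP <- /perm_to_rem/perm_sumn->.
exact: leq_addr.
Qed.

Lemma num_distinct_parts_card a s (f : 'I_n.+1 -> nat) (T : {set 'I_n.+1}) :
    injective f ->
    (forall i, reflect (exists2 t, t \in T & i = f t) (a i && (i \in s))) ->
  num_distinct_parts a s = #|T|.
Proof.
move=> f_inj memT.
rewrite /num_distinct_parts -size_filter cardE -(size_map f).
apply: perm_size; apply: uniq_perm.
- by rewrite filter_uniq ?undup_uniq.
- by rewrite map_inj_uniq ?enum_uniq.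
move=> i; rewrite mem_filter mem_undup.
by apply/memT/mapP => -[t Tt ->]; exists t; rewrite ?mem_enum // in Tt *.
Qed.

Lemma card_multiple_parts s : is_partition n s ->
  num_distinct_parts (fun i => k * b %| i) s = #|multiple_parts s|.
Proof.
move=> part_s; apply: (@num_distinct_parts_card _ _ (fun t => k * t)).
  move=> t u /eqP; rewrite eqn_pmul2l // => /eqP; exact: val_inj.
move=> i; apply: (iffP andP) => [[/dvdnP[q ->] s_i] | [t]]; last first.
  by rewrite inE => /andP[b_t s_t] ->; rewrite dvdn_pmul2l.
rewrite mulnCA in s_i *.
have lt_qb : q * b < n.+1.
  by rewrite ltnS (leq_trans (leq_pmull _ k_gt0)) // (part_le part_s).
by exists (Ordinal lt_qb); rewrite // inE /= dvdn_mull.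
Qed.

Lemma card_frequent_parts s : is_partition n s ->
  num_distinct_parts (fun i => (b %| i) && (k <= count_mem i s)) s
  = #|frequent_parts s|.
Proof.
move=> part_s; apply: (@num_distinct_parts_card _ _ val _ val_inj).
move=> i; apply: (iffP andP) => [[/andP[b_i le_ki] s_i] | [t]].
  have lt_in : i < n.+1 by rewrite ltnS (part_le part_s).
  by exists (Ordinal lt_in); rewrite // inE /= b_i.
rewrite inE => /andP[b_t le_kt] ->; rewrite b_t le_kt; split=> //.
by rewrite -has_pred1 has_count (leq_trans k_gt0).
Qed.

(** [multiples T] and [repeats T] are the least multisets of parts that force [T]
    into [multiple_parts] and into [frequent_parts] respectively, when [T]
    consists of multiples of [b]. *)
Definition multiples (T : {set 'I_n.+1}) : seq nat :=
  [seq k * val t | t <- enum T].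

Definition repeats (T : {set 'I_n.+1}) : seq nat :=
  flatten (nseq k [seq val t | t <- enum T]).

Lemma sub_multiple_parts (T : {set 'I_n.+1}) s :
  (T \subset multiple_parts s)
  = [forall t in T, b %| t] && contains (multiples T) s.
Proof.
have uniqT : uniq (multiples T).
  rewrite map_inj_uniq ?enum_uniq // => t u /eqP.
  by rewrite eqn_pmul2l // => /eqP; exact: val_inj.
have -> : contains (multiples T) s = all (mem s) (multiples T).
  apply: eq_in_all => x Tx.
  by rewrite count_uniq_mem // Tx -has_count has_pred1.
rewrite all_map.
apply/subsetP/andP => [subT | [/forall_inP bT /allP sT] t Tt].
  split; first by apply/forall_inP=> t /subT; rewrite inE => /andP[].
  by apply/allP=> t; rewrite mem_enum => /subT; rewrite inE => /andP[].
by rewrite inE bT //=; apply: sT; rewrite mem_enum.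
Qed.

Lemma sub_frequent_parts (T : {set 'I_n.+1}) s :
  (T \subset frequent_parts s)
  = [forall t in T, b %| t] && contains (repeats T) s.
Proof.
have uniqT : uniq [seq val t | t <- enum T].
  by rewrite (map_inj_uniq val_inj) enum_uniq.
have countT x : count_mem x (repeats T) = k * (x \in [seq val t | t <- enum T]).
  by rewrite count_flatten map_nseq sumn_nseq count_uniq_mem // mulnC.
have mem_repeats x : (x \in repeats T) = (x \in [seq val t | t <- enum T]).
  by rewrite -has_pred1 has_count countT muln_gt0 k_gt0 lt0b.
apply/subsetP/andP => [subT | [/forall_inP bT /allP sT] t Tt].
  split; first by apply/forall_inP=> t /subT; rewrite inE => /andP[].
  apply/allP=> x; rewrite countT mem_repeats => /mapP[t].
  rewrite mem_enum => /subT; rewrite inE => /andP[_ le_kt] ->.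
  by apply: leq_trans le_kt; case: (_ \in _); rewrite ?muln1 ?muln0.
have Tx : val t \in [seq val t | t <- enum T] by rewrite map_f ?mem_enum.
by rewrite inE bT //=; have := sT (val t); rewrite countT mem_repeats Tx muln1; apply.
Qed.

Lemma sumn_multiples T : sumn (multiples T) = sumn (repeats T).
Proof.
rewrite sumn_flatten map_nseq sumn_nseq /multiples.
by elim: (enum _) => //= t s ->; rewrite mulnDl mulnC.
Qed.

Lemma all_gt0_multiples T : all (leq 1) (multiples T) = all (leq 1) (repeats T).
Proof.
transitivity (all (leq 1) [seq val t | t <- enum T]).
  by rewrite !all_map; apply: eq_all => t /=; rewrite muln_gt0 k_gt0.
apply/allP/allP => gt0T x.
  by case/flattenP=> l /nseqP[-> _]; apply: gt0T.
move=> Tx; apply: gt0T; apply/flattenP.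
by exists [seq val t | t <- enum T]; rewrite // mem_nseq k_gt0 eqxx.
Qed.

(** The two prescribed multisets of parts have equal sums, and only the sum of
    a multiset of positive parts matters in [num_partitions_containing]; the
    element [0] of ['I_n.+1] is in neither statistic, and if it is in [T] then
    neither multiset has only positive elements. *)
Lemma num_partitions_sub (T : {set 'I_n.+1}) :
  num_partitions n (fun s => T \subset multiple_parts s)
  = num_partitions n (fun s => T \subset frequent_parts s).
Proof.
rewrite !num_partitionsE (eq_count (sub_multiple_parts T)).
rewrite (eq_count (sub_frequent_parts T)).
case: [forall t in T, b %| t] => //=.
rewrite -!num_partitionsE !num_partitions_containing.
by rewrite sumn_multiples all_gt0_multiples.
Qed.

End Statistics.

Theorem theorem1p1 (n j k b : nat) (hk : 1 <= k) (hb : 1 <= b) :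
  O_count j k b n = D_count j k b n.
Proof.
set D := [set s : n.-bseq 'I_n.+1 | is_partition n (parts_of s)].
pose A (s : n.-bseq 'I_n.+1) := multiple_parts n k b (parts_of s).
pose B (s : n.-bseq 'I_n.+1) := frequent_parts n k b (parts_of s).
have eqAB T : #|[set s in D | A s == T]| = #|[set s in D | B s == T]|.
  apply: card_fiber_eq T => T.
  have setE (C : seq nat -> {set 'I_n.+1}) :
      #|[set s in D | T \subset C (parts_of s)]|
      = num_partitions n (fun s => T \subset C s).
    by apply: eq_card => s; rewrite !inE.
  by rewrite !setE num_partitions_sub.
transitivity #|[set s in D | #|A s| == j]|.
  apply: eq_card => s; rewrite !inE; apply: andb_id2l => part_s.
  by rewrite (card_multiple_parts b hk part_s).
rewrite (card_level_eq _ eqAB).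
apply: eq_card => s; rewrite !inE; apply: andb_id2l => part_s.
by rewrite (card_frequent_parts b hk part_s).
Qed.
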